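(* Let $R\subset\mathbb R^d$ be a compact connected domain with piecewise smooth boundary and $b$ a boundary asymptotic flow such that $(R,b)$ is flexible. Let $\omega$ be the unique minimizer of $\int_R\sigma(\omega'(x))\,dx$ over $\omega'\in\mathrm{AF}(\Lambda,R,b)$. Then $\omega(x)$ lies in the interior of $\mathcal N(\Lambda)$ for almost every $x$ in the interior of $R$.
   Context: $e_1,\dots,e_D\in\mathbb R^d$ span $\mathbb R^d$ with $\sum e_i=0$ (edge vectors of the lattice $\Lambda$). $\mathcal N(\Lambda)=\mathrm{conv}\{e_1,\dots,e_D\}$, $\sigma(s)=\sup_{\alpha}(s\cdot\alpha-\log\sum_je^{e_j\cdot\alpha})$, which is strictly convex on $\mathcal N(\Lambda)$. An asymptotic flow on $R$ is a measurable vector field supported in $R$, divergence free in the interior of $R$ as a distribution, with values in $\mathcal N(\Lambda)$ a.e.; $T(\omega)=\langle\omega,\xi\rangle d\sigma_{\partial R}$ (extended continuously from smooth flows) is its boundary flux; $b=T(\omega_0)$ for some asymptotic flow $\omega_0$, and $\mathrm{AF}(\Lambda,R,b)=T^{-1}(b)$. $(R,b)$ is flexible if for every point $x$ in the interior of $R$ there are a neighbourhood $U$ of $x$ and $\omega'\in\mathrm{AF}(\Lambda,R,b)$ with $\omega'(y)$ in the interior of $\mathcal N(\Lambda)$ for a.e. $y\in U$. *)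

(* Defs.v *)
From HB Require Import structures.
From mathcomp Require Import all_boot all_order all_algebra.
From mathcomp Require Import all_classical all_reals all_analysis.

Set Implicit Arguments.
Unset Strict Implicit.
Unset Printing Implicit Defensive.

Import Order.TTheory GRing.Theory Num.Theory.
Import numFieldNormedType.Exports.

Local Open Scope classical_set_scope.
Local Open Scope ring_scope.

Section Defs.
Variable R : realType.

Definition dotv (d : nat) (u v : 'rV[R]_d) : R := \sum_(i < d) u ord0 i * v ord0 i.

Definition basisv (d : nat) (i : 'I_d) : 'rV[R]_d := \row_(j < d) (if j == i then 1 else 0).

Definition partial (d : nat) (i : 'I_d) (f : 'rV[R]_d -> R) : 'rV[R]_d -> R :=
  fun x => derive f x (basisv i).

Fixpoint Ck (d : nat) (k : nat) (f : 'rV[R]_d -> R) : Prop :=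
  match k with
  | 0 => continuous f
  | k'.+1 => continuous f /\
      forall i : 'I_d, (forall x, derivable f x (basisv i)) /\ Ck k' (partial i f)
  end.

Definition smooth (d : nat) (f : 'rV[R]_d -> R) : Prop := forall k, Ck k f.

Definition smooth_map (m d : nat) (g : 'rV[R]_m -> 'rV[R]_d) : Prop :=
  forall j : 'I_d, smooth (fun x => g x ord0 j).

Definition grad (d : nat) (f : 'rV[R]_d -> R) (x : 'rV[R]_d) : 'rV[R]_d :=
  \row_(i < d) partial i f x.

Definition jacobian (m d : nat) (g : 'rV[R]_m -> 'rV[R]_d) (x : 'rV[R]_m)
  : 'M[R]_(m, d) := \matrix_(k < m, j < d) partial k (fun y => g y ord0 j) x.

Definition borel (d : nat) (A : set 'rV[R]_d) : Prop := <<s [set U | open U] >> A.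

Definition borel_fun (d : nat) (f : 'rV[R]_d -> R) : Prop :=
  forall U : set R, open U -> borel (f @^-1` U).

(* Lebesgue integral on R^d, computed as an iterated integral of
   one-dimensional Lebesgue integrals (Fubini/Tonelli). *)
Fixpoint iint (d : nat) : ('rV[R]_d -> \bar R) -> \bar R :=
  match d with
  | 0 => fun f => f 0
  | d'.+1 => fun f =>
      (\int[@lebesgue_measure R]_(t in setT)
          iint (fun y : 'rV[R]_d' => f (row_mx (\row_(_ < 1) t) y)))%E
  end.

Definition leb (d : nat) (A : set 'rV[R]_d) : \bar R :=
  iint (fun x => (\1_A x)%:E).

Definition ae_in (d : nat) (U : set 'rV[R]_d) (P : 'rV[R]_d -> Prop) : Prop :=
  exists N : set 'rV[R]_d, borel N /\ leb N = 0%E /\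
    forall x, U x -> ~ N x -> P x.

Definition Newton (d D : nat) (e : 'I_D -> 'rV[R]_d) : set 'rV[R]_d :=
  [set s | exists lam : 'I_D -> R, (forall j, 0 <= lam j) /\
     \sum_(j < D) lam j = 1 /\ s = \sum_(j < D) lam j *: e j].

Definition spans (d D : nat) (e : 'I_D -> 'rV[R]_d) : Prop :=
  forall v : 'rV[R]_d, exists c : 'I_D -> R, v = \sum_(j < D) c j *: e j.

Definition sigma (d D : nat) (e : 'I_D -> 'rV[R]_d) (s : 'rV[R]_d) : \bar R :=
  ereal_sup [set ((dotv s a - ln (\sum_(j < D) expR (dotv (e j) a)))%:E)%E
               | a in [set: 'rV[R]_d]].

Definition is_domain (d : nat) (Rg : set 'rV[R]_d) : Prop :=
  closure (interior Rg) = Rg.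

Definition piecewise_smooth_boundary (d : nat) (Rg : set 'rV[R]_d) : Prop :=
  exists (m : nat) (K : 'I_m -> set 'rV[R]_(d.-1))
         (phi : 'I_m -> 'rV[R]_(d.-1) -> 'rV[R]_d),
    (forall i, compact (K i)) /\
    (forall i, smooth_map (phi i)) /\
    (forall i x, K i x -> \rank (jacobian (phi i) x) = d.-1) /\
    closure Rg `\` interior Rg = \bigcup_(i in [set: 'I_m]) (phi i @` K i).

Definition divergence_free_in (d : nat) (U : set 'rV[R]_d)
    (w : 'rV[R]_d -> 'rV[R]_d) : Prop :=
  forall phi : 'rV[R]_d -> R, smooth phi ->
    compact (closure [set x | phi x != 0]) ->
    closure [set x | phi x != 0] `<=` U ->
    iint (fun x => (dotv (w x) (grad phi x))%:E) = 0%E.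

Definition asymptotic_flow (d D : nat) (e : 'I_D -> 'rV[R]_d)
    (Rg : set 'rV[R]_d) (w : 'rV[R]_d -> 'rV[R]_d) : Prop :=
  (forall i : 'I_d, borel_fun (fun x => w x ord0 i)) /\
  (forall x, ~ Rg x -> w x = 0) /\
  divergence_free_in (interior Rg) w /\
  ae_in [set: 'rV[R]_d] (fun x => Newton e (w x)).

(* boundary flux pairing <T(w), phi> = int_R w . grad phi
   (= int_{dR} phi <w, xi> dsigma for smooth divergence-free w) *)
Definition flux (d : nat) (w : 'rV[R]_d -> 'rV[R]_d)
    (phi : 'rV[R]_d -> R) : \bar R :=
  iint (fun x => (dotv (w x) (grad phi x))%:E).

Definition same_flux (d : nat) (w w' : 'rV[R]_d -> 'rV[R]_d) : Prop :=
  forall phi : 'rV[R]_d -> R, smooth phi -> flux w phi = flux w' phi.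

(* AF(Lambda, R, b) with b = T(w0) *)
Definition AF (d D : nat) (e : 'I_D -> 'rV[R]_d) (Rg : set 'rV[R]_d)
    (w0 : 'rV[R]_d -> 'rV[R]_d) : set ('rV[R]_d -> 'rV[R]_d) :=
  [set w | asymptotic_flow e Rg w /\ same_flux w w0].

Definition flexible (d D : nat) (e : 'I_D -> 'rV[R]_d) (Rg : set 'rV[R]_d)
    (w0 : 'rV[R]_d -> 'rV[R]_d) : Prop :=
  forall x, interior Rg x ->
    exists U : set 'rV[R]_d, open U /\ U x /\
      exists w', AF e Rg w0 w' /\ ae_in U (fun y => interior (Newton e) (w' y)).

Definition entropy (d D : nat) (e : 'I_D -> 'rV[R]_d) (Rg : set 'rV[R]_d)
    (w : 'rV[R]_d -> 'rV[R]_d) : \bar R :=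
  iint (fun x => if x \in Rg then sigma e (w x) else 0%E).

End Defs.

(* Main.v *)
Require Import Defs.
From HB Require Import structures.
From mathcomp Require Import all_boot all_order all_algebra.
From mathcomp Require Import all_classical all_reals all_analysis.
From mathcomp Require Import measurable_realfun ring lra.
Import Order.TTheory GRing.Theory Num.Theory.
Import numFieldNormedType.Exports.
Local Open Scope classical_set_scope.
Local Open Scope ring_scope.

(** Suppose the minimizer [w] takes boundary values of the Newton polytope on a
non-null set inside a box on which some competitor [w'] is interior.  The
surface tension [sigma] is bounded on the polytope, but its one-sided slope at
a boundary point in an interior direction is [-oo]: mixing in a fraction [eps]
of [w'] lowers [sigma] by order [eps * ln (1 / eps)] there, while by convexity
it costs at most [O(eps)] elsewhere.  So the mixture has smaller entropy for
small [eps], and it has the same flux.  Countably many boxes cover the region. *)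

Set Implicit Arguments.
Unset Strict Implicit.
Unset Printing Implicit Defensive.

(** * The surface tension near the boundary of the Newton polytope *)

(** The slope [-oo] is reached without differentiating the supremum [sigma]. For each dual vector
    [a], let [q] be the share in the partition sum of a vertex off the exposed face. If [q] is not
    small, the bound at the boundary point improves by [q]; if it is small, the bound at the
    interior point improves by [m * |ln q|], where [m] is a lower bound for its barycentric weights.
    With [c = eps * m], the worst case of [c * ln q - q / 2] is at [q = 2 * c], and this is where
    the logarithm of [eps] comes from.

    The gain survives integration only if [m] is the same on a set of positive measure. Interiority
    of the value [t] of the competitor is therefore graded: for some [n], the dilate of [t] by
    [1 + 1 / (n + 1)] is still in the polytope, and only countably many [n] occur.

    The other obstacle is [iint], an iterated integral of arbitrary functions, with no additivity or
    monotonicity in general. It is first identified with the integral against a sigma-finite Borel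
    measure, on integrable and on nonnegative measurable functions. *)

Section DotProduct.
Variables (R : realType) (d : nat).
Implicit Types u v a s : 'rV[R]_d.

Lemma dotvC u v : dotv u v = dotv v u.
Proof. by apply: eq_bigr => i _; rewrite mulrC. Qed.

Lemma dotvDl u v a : dotv (u + v) a = dotv u a + dotv v a.
Proof. by rewrite -big_split; apply: eq_bigr => i _; rewrite mxE mulrDl. Qed.

Lemma dotvZl k u a : dotv (k *: u) a = k * dotv u a.
Proof. by rewrite mulr_sumr; apply: eq_bigr => i _; rewrite mxE mulrA. Qed.

Lemma dotvBl u v a : dotv (u - v) a = dotv u a - dotv v a.
Proof. by rewrite -scaleN1r dotvDl dotvZl mulN1r. Qed.

Lemma dotvDr u v a : dotv a (u + v) = dotv a u + dotv a v.
Proof. by rewrite dotvC dotvDl !(dotvC a). Qed.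

Lemma dotvZr k u a : dotv a (k *: u) = k * dotv a u.
Proof. by rewrite dotvC dotvZl dotvC. Qed.

Lemma dotv0l a : dotv 0 a = 0.
Proof. by rewrite /dotv big1 // => i _; rewrite mxE mul0r. Qed.

Lemma dotv_suml (I : finType) (c : I -> R) (e : I -> 'rV[R]_d) a :
  dotv (\sum_j c j *: e j) a = \sum_j c j * dotv (e j) a.
Proof.
rewrite (big_morph (fun u => dotv u a) (id1 := 0) (op1 := +%R)).
- by apply: eq_bigr => j _; rewrite dotvZl.
- by move=> u v; exact: dotvDl.
- exact: dotv0l.
Qed.

Lemma dotv_basisv u i : dotv u (basisv R i) = u ord0 i.
Proof.
rewrite /dotv (bigD1 i) //= big1 ?addr0; last first.
  by move=> j /negPf ji; rewrite !mxE ji mulr0.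
by rewrite !mxE eqxx mulr1.
Qed.

Lemma dotvv_eq0 v : dotv v v = 0 -> v = 0.
Proof.
move=> v0; apply/rowP => i; rewrite mxE; apply/eqP.
rewrite -sqrf_eq0 expr2; move/psumr_eq0P : v0 => v0.
by apply/eqP/v0 => // j _; rewrite -expr2 sqr_ge0.
Qed.

Lemma sum_continuous (T : topologicalType) (I : finType) (P : pred I)
    (f : I -> T -> R) : (forall i, P i -> continuous (f i)) ->
  continuous (fun x => \sum_(i | P i) f i x).
Proof. by move=> fc; apply: continuous_big => //; exact: add_continuous. Qed.

Lemma dotv_continuous u : continuous (dotv u).
Proof.
apply: sum_continuous => i _ v.
exact: cvgM (cvg_cst _) (@coord_continuous _ _ _ ord0 i v).
Qed.

End DotProduct.

Lemma nbhs_rowP (R : realType) (d : nat) (x : 'rV[R]_d) (A : set 'rV[R]_d) :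
  nbhs x A <->
  exists2 r : R, 0 < r & forall y : 'rV[R]_d, (forall i, `|x ord0 i - y ord0 i| < r) -> A y.
Proof.
split.
  move=> /nbhs_ballP[r /= r0 rA]; exists r => // y xy; apply: rA; split => // i j.
  by rewrite (ord1 i); exact: xy.
move=> [r r0 rA]; apply/nbhs_ballP; exists r => // y [_ xy]; apply: rA => i.
exact: xy.
Qed.

Lemma sum1_ord_gt0 (R : realType) (n : nat) (l : 'I_n -> R) :
  \sum_j l j = 1 -> (0 < n)%N.
Proof. by case: n l => // l /eqP; rewrite big_ord0 eq_sym oner_eq0. Qed.

Lemma ln_le_subr1 (R : realType) (x : R) : 0 < x -> ln x <= x - 1.
Proof.
move=> x0; have -> : ln x = ln (1 + (x - 1)) by rewrite addrC subrK.
by apply: le_ln1Dx; rewrite ltrBrDr addNr.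
Qed.

Section NewtonSigma.
Variables (R : realType) (d D : nat) (e : 'I_D -> 'rV[R]_d).
Implicit Types s t v a : 'rV[R]_d.

Let Z a : R := \sum_j expR (dotv (e j) a).

Lemma Newton_card s : Newton e s -> (0 < D)%N.
Proof.
by move=> [lam [_ [/sum1_ord_gt0]]].
Qed.

Lemma expR_le_partition j a : expR (dotv (e j) a) <= Z a.
Proof.
by rewrite /Z (bigD1 j) //= lerDl sumr_ge0 // => i _; exact: expR_ge0.
Qed.

Lemma partition_gt0 (j : 'I_D) a : 0 < Z a.
Proof. exact: lt_le_trans (expR_gt0 _) (expR_le_partition j a). Qed.

Lemma dotv_le_ln_partition j a : dotv (e j) a <= ln (Z a).
Proof.
rewrite -ler_expR lnK ?expR_le_partition// posrE; exact: partition_gt0 j a.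
Qed.

Lemma Newton_convex s t k : Newton e s -> Newton e t -> 0 <= k <= 1 ->
  Newton e ((1 - k) *: s + k *: t).
Proof.
move=> [l [l0 [l1 ->]]] [m [m0 [m1 ->]]] /andP[k0 k1].
exists (fun j => (1 - k) * l j + k * m j); split; [|split].
- by move=> j; rewrite addr_ge0 // mulr_ge0 // subr_ge0.
- by rewrite big_split /= -!mulr_sumr l1 m1 !mulr1 subrK.
- rewrite !scaler_sumr -big_split /=; apply: eq_bigr => j _.
  by rewrite !scalerA -scalerDl.
Qed.

Lemma Newton_coord_bound :
  exists2 M : R, 0 <= M & forall s, Newton e s -> forall i, `|s ord0 i| <= M.
Proof.
exists (\sum_j \sum_i `|e j ord0 i|).
  by apply: sumr_ge0 => j _; apply: sumr_ge0.
move=> s [l [l0 [l1 ->]]] i; rewrite summxE.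
apply: le_trans (ler_norm_sum _ _ _) _.
apply: ler_sum => j _; rewrite mxE normrM ger0_norm //.
apply: (@le_trans _ _ `|e j ord0 i|).
  rewrite ler_piMl // -l1 (bigD1 j) //= lerDl; exact: sumr_ge0.
by rewrite (bigD1 i) //= lerDl; exact: sumr_ge0.
Qed.

Lemma Newton_dotv_le_ln s a : Newton e s -> dotv s a <= ln (Z a).
Proof.
move=> [l [l0 [l1 ->]]]; rewrite dotv_suml -[leRHS]mul1r -l1 mulr_suml.
by apply: ler_sum => j _; apply: ler_wpM2l => //; exact: dotv_le_ln_partition.
Qed.

Lemma sigma_le s (r : R) :
  (sigma e s <= r%:E)%E <-> forall a, dotv s a - ln (Z a) <= r.
Proof.
split=> [sr a|sr].
  by rewrite -lee_fin; apply: le_trans sr; apply: ereal_sup_ubound; exists a.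
by apply: ge_ereal_sup => _ [a _ <-]; rewrite lee_fin; exact: sr.
Qed.

Lemma sigma_le0 s : Newton e s -> (sigma e s <= 0)%E.
Proof.
by move=> Ns; apply/sigma_le => a; rewrite subr_le0; exact: Newton_dotv_le_ln.
Qed.

(** The test vector [a = 0] makes every exponential equal to 1. Together with [sigma_le0] this gives
    the bound [ln D] that controls the cost of mixing. *)
Lemma sigma_ge s : ((- ln D%:R)%:E <= sigma e s)%E.
Proof.
apply: ereal_sup_ubound; exists 0 => //=; congr (_%:E).
have dotv0r u : dotv u 0 = 0 :> R by rewrite dotvC dotv0l.
rewrite dotv0r sub0r; congr (- ln _).
rewrite (eq_bigr (fun=> 1)) ?sumr_const ?card_ord // => j _.
by rewrite dotv0r expR0.
Qed.

(** Convexity, with the contribution of [t] bounded by 0. It serves at the points where no steepness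
    is available. *)
Lemma sigma_convex_le s t (k r : R) : Newton e t -> 0 <= k <= 1 ->
  (sigma e s <= r%:E)%E ->
  (sigma e ((1 - k) *: s + k *: t) <= ((1 - k) * r)%:E)%E.
Proof.
move=> Nt /andP[k0 k1] /sigma_le sr; apply/sigma_le => a.
have ta := Newton_dotv_le_ln a Nt.
rewrite dotvDl !dotvZl.
have : 0 <= k * (ln (Z a) - dotv t a) by rewrite mulr_ge0 // subr_ge0.
have : 0 <= (1 - k) * (r - (dotv s a - ln (Z a))).
  by rewrite mulr_ge0 // subr_ge0.
lra.
Qed.

(* Moving [a] to infinity along the supporting vector [v] kills the terms
   outside the face exposed by [v]. *)
Lemma sigma_face_le (j0 : 'I_D) s v (r : R) :
  (sigma e s <= r%:E)%E ->
  (forall j, dotv (e j) v <= dotv s v) ->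
  forall a, expR (dotv s a - r) <=
    \sum_(j | dotv (e j) v == dotv s v) expR (dotv (e j) a).
Proof.
move=> /sigma_le sr sv a.
set F := fun j => dotv (e j) v == dotv s v.
pose c j := dotv s v - dotv (e j) v.
pose C := \sum_(j | ~~ F j) expR (dotv (e j) a) / c j.
have cpos j : ~~ F j -> 0 < c j.
  by move=> Fj; rewrite subr_gt0 lt_neqAle sv Fj.
have C0 : 0 <= C.
  by apply: sumr_ge0 => j Fj; rewrite divr_ge0 ?expR_ge0 // ltW // cpos.
(* The bound on [sigma] is tested at [a + k *: v]. A term off the face carries a factor
   [expR (- (k * c j))], at most [1 / (k * c j)], so [C / k] vanishes as [k] grows. *)
suff key k : 0 < k -> expR (dotv s a - r) <=
    \sum_(j | F j) expR (dotv (e j) a) + C / k.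
  apply/ler_addgt0Pr => eps eps0.
  apply: le_trans (key ((C + 1) / eps) _) _.
    by rewrite divr_gt0 // ltr_wpDl.
  rewrite lerD2l invf_div mulrCA ger_pMr //.
  by rewrite ler_pdivrMr ?mul1r ?lerDl ?ler01 // ltr_wpDl.
move=> k0.
have Dpos : 0 < Z (a + k *: v) := partition_gt0 j0 _.
have := sr (a + k *: v) => h.
rewrite lerBlDr -lerBlDl in h.
rewrite -ler_expR lnK ?posrE // in h.
rewrite dotvDr dotvZr addrAC expRD in h.
rewrite -(ler_pM2r (expR_gt0 (k * dotv s v))).
apply: le_trans h _.
rewrite /Z (bigID F) /= mulrDl; apply: lerD.
  rewrite mulr_suml; apply: ler_sum => j /eqP Fj.
  by rewrite dotvDr dotvZr expRD Fj.
rewrite /C mulr_suml mulr_suml; apply: ler_sum => j Fj.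
rewrite dotvDr dotvZr expRD -!mulrA ler_pM2l ?expR_gt0 //.
have -> : k * dotv (e j) v = k * dotv s v - k * c j by rewrite /c; ring.
rewrite expRD mulrC mulrA ler_pM2r ?expR_gt0 // expRN -invfM.
rewrite lef_pV2 ?posrE ?expR_gt0 ?mulr_gt0 ?cpos // mulrC.
by apply: le_trans (expR_ge1Dx _); rewrite lerDr.
Qed.

(** Two bounds compete for each [a]: the face estimate at [s] gains [q], the weights of [t] gain
    [m * ln q], and their combination is estimated uniformly in [q]. The constant depends on [t]
    only through the dilation factor [1 + k]. *)
Lemma sigma_steep s t v (k eps r : R) :
  Newton e s -> \sum_j e j = 0 ->
  (forall j, dotv (e j) v <= dotv s v) ->
  (exists j, dotv (e j) v < dotv s v) ->
  0 < k -> Newton e ((1 + k) *: t) -> 0 < eps <= 2^-1 ->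
  (sigma e s <= r%:E)%E -> let c := eps * (k / (1 + k) / D%:R) in
  (sigma e ((1 - eps) *: s + eps *: t) <= ((1 - eps) * r + c * ln (2 * c))%:E)%E.
Proof.
move=> Ns e0 sv [j0 j0v] k0 [l [l0 [l1 tl]]] /andP[eps0 epsh] sr; set c := eps * _.
have k10 : 0 < 1 + k by rewrite ltr_pwDl // ltW.
have D0 : 0 < D%:R :> R by rewrite ltr0n; exact: Newton_card Ns.
pose m := k / (1 + k) / D%:R.
have m0 : 0 < m by rewrite !divr_gt0.
have c0 : 0 < c by rewrite mulr_gt0.
(* Since the [e j] sum to 0, adding [m] to each weight leaves [t] unchanged. The weights
   [l j / (1 + k) + m] sum to 1, and each is at least [m]. *)
have tE a : dotv t a = (1 + k)^-1 * \sum_j l j * dotv (e j) a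
    + m * \sum_j dotv (e j) a.
  have <- : dotv (\sum_j 1 *: e j) a = \sum_j dotv (e j) a.
    by rewrite dotv_suml; under eq_bigr do rewrite mul1r.
  under [in X in _ + _ * X]eq_bigr do rewrite scale1r.
  rewrite e0 dotv0l mulr0 addr0 -dotv_suml -tl dotvZl mulrA mulVf ?mul1r //.
  by rewrite gt_eqF.
apply/sigma_le => a.
set L := ln (Z a).
have Zpos : 0 < Z a := partition_gt0 j0 a.
pose q := expR (dotv (e j0) a) / Z a.
have q0 : 0 < q by rewrite divr_gt0 // expR_gt0.
have lnq : ln q = dotv (e j0) a - L.
  by rewrite /q ln_div ?posrE ?expR_gt0 // expRK.
have ta : dotv t a <= L + m * ln q.
  have h1 : \sum_j l j * dotv (e j) a <= L.
    rewrite -[leRHS]mul1r -l1 mulr_suml; apply: ler_sum => j _.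
    by apply: ler_wpM2l => //; exact: dotv_le_ln_partition.
  have h2 : \sum_j dotv (e j) a <= D%:R * L + ln q.
    have -> : D%:R * L = L + \sum_(j < D | j != j0) L.
      by rewrite -(bigD1 j0 (P := predT) (F := fun=> L)) //= sumr_const card_ord mulr_natl.
    rewrite lnq (bigD1 j0) //=.
    have : \sum_(j < D | j != j0) dotv (e j) a <= \sum_(j < D | j != j0) L.
      by apply: ler_sum => j _; exact: dotv_le_ln_partition.
    lra.
  rewrite tE.
  have : (1 + k)^-1 * \sum_j l j * dotv (e j) a <= (1 + k)^-1 * L.
    by rewrite ler_pM2l // invr_gt0.
  have : m * \sum_j dotv (e j) a <= m * (D%:R * L + ln q) by rewrite ler_pM2l.
  have -> : m * (D%:R * L + ln q) = k / (1 + k) * L + m * ln q.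
    by rewrite /m; field; rewrite gt_eqF //= gt_eqF.
  have : (1 + k)^-1 * L + k / (1 + k) * L = L by field; rewrite gt_eqF.
  lra.
(* The vertex [j0] is off the face, so the face sum is at most [(1 - q) * Z a]; then
   [ln x <= x - 1]. *)
have sa : dotv s a <= r + L - q.
  have := sigma_face_le j0 sr sv a; set X := expR _ => Xle.
  have {}Xle : X <= Z a - expR (dotv (e j0) a).
    apply: le_trans Xle _; rewrite lerBrDl /Z [leRHS](bigD1 j0) //= lerD2l.
    rewrite big_mkcond [leRHS]big_mkcond /=; apply: ler_sum => j _.
    have [->|jj0] := eqVneq j j0; first by rewrite lt_eqF.
    by case: ifP; rewrite ?expR_ge0.
  have : X / Z a <= 1 - q.
    by rewrite ler_pdivrMr // mulrBl mul1r divfK // gt_eqF.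
  have := ln_le_subr1 (divr_gt0 (expR_gt0 (dotv s a - r)) Zpos).
  rewrite ln_div ?posrE ?expR_gt0 // expRK -/L -/X; lra.
(* The tangent of the concave function [c * ln] at [2 * c] has slope [1 / 2]. The term [q / 2] is
   absorbed by [(1 - eps) * q], as [eps <= 1 / 2]. *)
have lnc : c * ln q <= c * ln (2 * c) + q / 2 - c.
  have c20 : 0 < 2 * c by rewrite mulr_gt0.
  have := ln_le_subr1 (divr_gt0 q0 c20).
  rewrite ln_div ?posrE // -(ler_pM2l c0).
  have -> : c * (q / (2 * c) - 1) = q / 2 - c.
    by field; rewrite gt_eqF.
  lra.
rewrite dotvDl !dotvZl.
have : (1 - eps) * dotv s a <= (1 - eps) * (r + L - q).
  by rewrite ler_wpM2l //; lra.
have : eps * dotv t a <= eps * L + c * ln q.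
  by rewrite /c -mulrA -mulrDr ler_pM2l.
have : 2^-1 * q <= (1 - eps) * q by rewrite ler_pM2r //; lra.
lra.
Qed.

(** * Interior points and supporting vectors of the Newton polytope *)

Hypothesis spe : spans e.
Hypothesis e0 : \sum_j e j = 0.

(** If all vertices lay on the supporting hyperplane, summing them would give [dotv s v = 0]. Then
    [v] would be orthogonal to a spanning family, hence zero. *)
Lemma supporting_strict s v : v != 0 ->
  (forall j, dotv (e j) v <= dotv s v) -> (0 < D)%N ->
  exists j, dotv (e j) v < dotv s v.
Proof.
move=> v0 sv D0; apply: contrapT => /forallNP h.
have ev j : dotv (e j) v = dotv s v.
  by apply/eqP; rewrite eq_le sv leNgt; apply/negP/h.
have sv0 : dotv s v = 0.
  have : dotv (\sum_j 1 *: e j) v = 0.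
    by under eq_bigr do rewrite scale1r; rewrite e0 dotv0l.
  rewrite dotv_suml; under eq_bigr do rewrite mul1r ev.
  rewrite sumr_const card_ord => /eqP; rewrite mulrn_eq0.
  by rewrite eqn0Ngt D0 => /eqP.
have [c vc] := spe v.
move/eqP: v0; apply; apply: dotvv_eq0.
rewrite {1}vc dotv_suml big1 // => j _.
by rewrite ev sv0 mulr0.
Qed.

(* A small displacement is a small combination of the [e j]; it can be
   recentred, as [\sum_j e j = 0], so that the weights still sum to one. *)
Lemma interior_barycentre (p : 'I_D -> R) :
  (forall j, 0 < p j) -> \sum_j p j = 1 ->
  interior (Newton e) (\sum_j p j *: e j).
Proof.
move=> p0 p1.
have [c cE] := choice (fun i => spe (basisv R i)).
pose C : R := 1 + \sum_i \sum_j `|c i j|.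
have C0 : 0 < C.
  by rewrite ltr_pwDl // sumr_ge0 // => i _; apply: sumr_ge0.
pose pm : R := \big[Num.min/1]_j p j.
have pm0 : 0 < pm by apply/lt_bigmin.
have pmle j : pm <= p j by exact: bigmin_le.
have D0 : (0 < D)%N.
  exact: sum1_ord_gt0 p1.
have D0R : 0 < D%:R :> R by rewrite ltr0n.
(* With this radius the correction [b j] and the recentring by its average each cost at most
   [pm / 2], so the new weights stay nonnegative. *)
apply/nbhs_rowP; exists (pm / (2 * C)); first by rewrite divr_gt0 // mulr_gt0.
set s := \sum_j _ => y sy.
pose u := y - s.
pose b j := \sum_i u ord0 i * c i j.
have uE : u = \sum_j b j *: e j.
  transitivity (\sum_i u ord0 i *: basisv R i).
    apply/rowP => i; rewrite summxE (bigD1 i) //= big1 ?addr0.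
      by rewrite !mxE eqxx mulr1.
    by move=> k ki; rewrite !mxE eq_sym (negPf ki) mulr0.
  under eq_bigr do rewrite cE scaler_sumr.
  rewrite exchange_big; apply: eq_bigr => j _.
  by rewrite scaler_suml; apply: eq_bigr => i _; rewrite scalerA.
have sumb j : `|b j| <= pm / 2.
  apply: (@le_trans _ _ (\sum_i (pm / (2 * C)) * \sum_j `|c i j|)).
    apply: le_trans (ler_norm_sum _ _ _) _.
    apply: ler_sum => i _; rewrite normrM; apply: ler_pM => //.
      by rewrite /u !mxE distrC ltW.
    by rewrite (bigD1 j) //= lerDl sumr_ge0.
  rewrite -mulr_sumr.
  apply: (@le_trans _ _ (pm / (2 * C) * C)).
    rewrite ler_pM2l ?divr_gt0 ?mulr_gt0 // /C lerDr //.
  by rewrite le_eqVlt; apply/orP; left; apply/eqP; field; rewrite gt_eqF.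
exists (fun j => p j + b j - (\sum_i b i) / D%:R); split; [|split].
- move=> j.
  have avg : (\sum_i b i) / D%:R <= pm / 2.
    rewrite ler_pdivrMr //; apply: le_trans (ler_norm _) _.
    apply: le_trans (ler_norm_sum _ _ _) _.
    apply: le_trans (ler_sum (G := fun=> pm / 2) _ _) _ => //.
    by rewrite sumr_const card_ord mulr_natr.
  move: (sumb j) (pmle j); rewrite ler_norml => /andP[+ _]; lra.
- rewrite !big_split /= p1 sumr_const card_ord mulNrn -(mulr_natr (_ / _)) divfK ?gt_eqF ?addrK //.
- rewrite -[y in LHS](subrK s) -/u uE addrC /s -big_split /=.
  under [RHS]eq_bigr do rewrite scalerBl scalerDl.
  by rewrite [RHS]big_split /= sumrN -scaler_sumr e0 scaler0 subr0.
Qed.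

(* Otherwise [a |-> \sum_j expR (dotv (e j - s) a)] is coercive, and its
   critical point exhibits [s] as a barycentre with positive weights. *)
Lemma exists_supporting s : Newton e s -> ~ interior (Newton e) s ->
  exists2 v, v != 0 & forall j, dotv (e j) v <= dotv s v.
Proof.
move=> Ns nint; apply: contrapT => nov; apply: nint.
have D0 := Newton_card Ns.
pose y j v := dotv (e j - s) v.
have strict v : v != 0 -> exists j, 0 < y j v.
  move=> v0; apply: contrapT => /forallNP h; apply: nov; exists v => // j.
  rewrite -subr_le0 -dotvBl leNgt; exact/negP/h.
have yc j : continuous (y j) by exact: dotv_continuous.
(* [h] is a positively homogeneous minorant of the exponential sum [f], positive off 0; its minimum
   on the unit sphere gives linear growth. *)
pose h v := \sum_j Num.max 0 (y j v).
have hc : continuous h.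
  apply: sum_continuous => j _ v.
  exact: continuous_max (@cst_continuous _ _ _ v) (yc j v).
have hpos v : v != 0 -> 0 < h v.
  move=> /strict[j yj]; rewrite /h (bigD1 j) //= ltr_pwDl //.
    by rewrite lt_max yj orbT.
  by apply: sumr_ge0 => i _; rewrite le_max lexx.
have hhom (k : R) v : 0 <= k -> h (k *: v) = k * h v.
  move=> k0; rewrite /h mulr_sumr; apply: eq_bigr => j _.
  by rewrite /y dotvZr maxr_pMr // mulr0.
have [c c0 hge] : exists2 c : R, 0 < c & forall v, c * `|v| <= h v.
  pose S := [set v : 'rV[R]_d | `|v| = 1].
  have onS (v : 'rV[R]_d) : v != 0 -> S (`|v|^-1 *: v).
    by move=> v0; rewrite /S /= normrZ normfV normr_id mulVf // normr_eq0.
  have [S0|/set0P/negP/negPn/eqP S0] := pselect (S !=set0); last first.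
    exists 1 => // v; have [->|/onS] := eqVneq v 0; last by rewrite S0.
    rewrite normr0 mulr0; apply: sumr_ge0 => i _; by rewrite le_max lexx.
  have cS : compact S.
    apply: bounded_closed_compact.
      by exists 1; split => // M M1 v /= ->; exact: ltW.
    rewrite (_ : S = (fun v : 'rV[R]_d => `|v|) @^-1` [set 1]) //.
    apply: closed_comp => [v _|]; [exact: norm_continuous|exact: closed_eq].
  have [u uS umin] := EVT_min_rV S0 cS (continuous_subspaceT hc).
  have u0 : u != 0.
    by apply/eqP => u0; move: uS; rewrite u0 inE /S /= normr0 => /esym/eqP; rewrite oner_eq0.
  exists (h u); first exact: hpos.
  move=> v; have [->|v0] := eqVneq v 0.
    rewrite normr0 mulr0; apply: sumr_ge0 => i _; by rewrite le_max lexx.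
  have vn : 0 < `|v| by rewrite normr_gt0.
  have := umin (`|v|^-1 *: v); rewrite inE => /(_ (onS _ v0)).
  by rewrite hhom ?invr_ge0 // mulrC ler_pdivlMr.
pose f v := \sum_j expR (y j v).
have fc : continuous f.
  apply: sum_continuous => j _ v.
  exact: continuous_comp (yc j v) (@continuous_expR R _).
have fh v : h v <= f v.
  apply: ler_sum => j _; rewrite ge_max expR_ge0 /=.
  by apply: le_trans (expR_ge1Dx _); rewrite lerDr.
have f0 : f 0 = D%:R.
  rewrite /f (eq_bigr (fun=> 1)) ?sumr_const ?card_ord // => j _.
  by rewrite /y dotvC dotv0l expR0.
(* Outside this ball [f v >= h v >= c * |v| > D = f 0], so a minimum over [B] is global. *)
pose B := [set v : 'rV[R]_d | `|v| <= D%:R / c].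
have B0 : B 0 by rewrite /B /= normr0 divr_ge0 // ltW.
have cB : compact B.
  apply: bounded_closed_compact.
    exists (D%:R / c); split; first exact: num_real.
    by move=> M M1 v /= vB; exact: le_trans vB (ltW M1).
  rewrite (_ : B = (fun v : 'rV[R]_d => `|v|) @^-1` [set x | x <= D%:R / c]) //.
  apply: closed_comp => [v _|]; [exact: norm_continuous|exact: closed_le].
have [] := @EVT_min_rV R d f B _ cB (continuous_subspaceT fc); first by exists 0.
move=> a aB amin.
have {}amin v : f a <= f v.
  have [vB|vB] := leP `|v| (D%:R / c); first by apply: amin; rewrite inE.
  apply: le_trans (amin 0 _) _; rewrite ?inE // f0.
  apply: le_trans (fh v); apply: le_trans (hge v).
  by rewrite mulrC -ler_pdivrMr // ltW.
pose w j := expR (y j a).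
have crit u : \sum_j w j * y j u = 0.
  pose g : R -> R := \sum_(j < D) (fun tau => w j * expR (tau * y j u)).
  have gE tau : g tau = f (a + tau *: u).
    rewrite /g fct_sumE; apply: eq_bigr => j _.
    by rewrite /w -expRD /y dotvDr dotvZr.
  have gd (tau : R) : is_derive tau (1 : R) g (\sum_(j < D) w j * (y j u * expR (tau * y j u))).
    apply: is_derive_sum => j.
    have hl : is_derive tau (1 : R) (y j u \*: (id : R -> R)) (y j u).
      by apply: is_derive_eq; rewrite /GRing.scale /= mulr1.
    have he := is_derive1_comp (is_derive_expR ((y j u \*: (id : R -> R)) tau)) hl.
    have := @is_deriveZ _ _ _ _ (w j) _ _ _ he.
    rewrite /GRing.scale /= => hw.
    rewrite (_ : (fun _ => _) = (w j \*: (expR \o (y j u \*: (id : R -> R))))).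
      by apply: is_derive_eq hw _; rewrite (mulrC tau) [_ * y j u]mulrC.
    by apply/funext => t /=; rewrite /GRing.scale /= [t * _]mulrC.
  have : is_derive (0 : R) (1 : R) g 0.
    apply: (@derive1_at_min _ g (-1) 1).
    - by rewrite ge0_cp.
    - by move=> t _; have [] := gd t.
    - by rewrite in_itv /= ltrN10 ltr01.
    by move=> t _; rewrite !gE scale0r addr0.
  move=> [_ g0]; have [_] := gd 0; rewrite g0 => hs; rewrite [RHS]hs.
  by apply: eq_bigr => j _; rewrite mul0r expR0 mulr1.
pose W := \sum_j w j.
have W0 : 0 < W.
  rewrite /W (bigD1 (Ordinal D0)) //= ltr_pwDl ?expR_gt0 //.
  by apply: sumr_ge0 => *; exact: expR_ge0.
(* Criticality along the [i]-th basis vector is the [i]-th coordinate of this identity. *)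
have -> : s = \sum_j (w j / W) *: e j.
  apply/rowP => i.
  have := crit (basisv R i).
  under eq_bigr do rewrite /y dotv_basisv !mxE mulrBr.
  rewrite sumrB -mulr_suml -/W => /eqP; rewrite subr_eq0 => /eqP hi.
  apply: (@mulfI _ W); first by rewrite gt_eqF.
  rewrite -hi summxE mulr_sumr; apply: eq_bigr => j _.
  by rewrite mxE [in RHS]mulrCA !mulrA divfK ?gt_eqF //; ring.
apply: interior_barycentre => [j|]; first by rewrite divr_gt0 ?expR_gt0.
by rewrite -mulr_suml mulfV // gt_eqF.
Qed.
(** This grades interiority by an integer, which yields the dilation factor for [sigma_steep]
    uniformly on each grade. *)
Lemma interior_Newton_dilate t : interior (Newton e) t ->
  exists n, interior (Newton e) ((1 + n.+1%:R^-1) *: t).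
Proof.
move=> tN.
have /nbhs_rowP[r r0 rN] : nbhs t (interior (Newton e)).
  by apply: open_nbhs_nbhs; split => //; exact: open_interior.
pose M : R := 1 + \sum_i `|t ord0 i|.
have M0 : 0 < M by rewrite ltr_pwDl // sumr_ge0.
pose n := Num.trunc (M / r).
exists n; apply: rN => i.
rewrite !mxE mulrDl mul1r opprD addrA subrr sub0r normrN normrM.
rewrite ger0_norm ?invr_ge0 // mulrC ltr_pdivrMr // mulrC.
have : M / r < n.+1%:R by apply: truncnS_gt.
rewrite ltr_pdivrMr // => /(le_lt_trans _); apply.
by rewrite /M (bigD1 i) //= addrCA lerDl addr_ge0 // sumr_ge0.
Qed.

End NewtonSigma.

(** * Iterated integrals as integrals against a measure *)

(** An alias of the row vectors on which [measurable] is convertible to [borel]. *)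
Definition borelRow (R : realType) (d : nat) :=
  g_sigma_algebraType [set U : set 'rV[R]_d | open U].

HB.instance Definition _ (R : realType) (d : nat) :=
  Measurable.on (borelRow R d).

(** * Borel measurability of row vectors through rational boxes *)

Section BorelRow.
Variables (R : realType) (d : nat).
Local Notation bR := (borelRow R d).

(** A base of the topology indexed by a countable type. It reduces measurability of row-valued maps
    to coordinates, and it later covers the region. *)
Definition ratbox (q : {ffun 'I_d -> rat} * nat) : set 'rV[R]_d :=
  [set x | forall i, `|x ord0 i - ratr (q.1 i)| < q.2.+1%:R^-1].

Lemma open_ratbox q : open (ratbox q).
Proof.
rewrite (_ : ratbox q = \bigcap_(i in [set: 'I_d])
   (fun x : 'rV[R]_d => x ord0 i) @^-1` (ball (ratr (q.1 i) : R) q.2.+1%:R^-1)).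
  rewrite -[X in open X]setCK setC_bigcap; apply: closed_openC.
  apply: closed_bigcup; [exact: finite_finset|move=> i _; apply: open_closedC].
  apply: open_comp => [x _|]; [exact: coord_continuous|exact: ball_open].
apply/seteqP; split => x h i /=.
  by move=> _; rewrite /ball /= distrC; exact: h.
by have := h i I; rewrite /ball /= distrC.
Qed.

Lemma ratbox_basis (U : set 'rV[R]_d) (x : 'rV[R]_d) : open U -> U x ->
  exists2 q, ratbox q x & ratbox q `<=` U.
Proof.
move=> oU Ux; have /nbhs_rowP[r r0 rU] : nbhs x U by exact: open_nbhs_nbhs.
pose n := Num.trunc (2 / r).
have n0 : 0 < n.+1%:R^-1 :> R by rewrite invr_gt0.
have nr : n.+1%:R^-1 + n.+1%:R^-1 < r.
  have : 2 / r < n.+1%:R by apply: truncnS_gt.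
  rewrite ltr_pdivrMr // -ltr_pdivrMl // mulrC => h.
  by rewrite (_ : _ + _ = 2 / n.+1%:R) //; ring.
have /choice[q qE] i : exists q : rat, `|x ord0 i - ratr q| < n.+1%:R^-1.
  have /rat_in_itvoo[q] : x ord0 i - n.+1%:R^-1 < x ord0 i + n.+1%:R^-1.
    by rewrite ltrBlDr -addrA ltrDl addr_gt0.
  by rewrite in_itv /= => qx; exists q; rewrite ltr_distlC.
exists ([ffun i => q i], n) => [i|y yq] /=; first by rewrite ffunE.
apply: rU => i; have /= := yq i; rewrite ffunE => yi.
rewrite -(subrK (ratr (q i)) (x ord0 i)) -addrA.
apply: le_lt_trans (ler_normD _ _) _; apply: lt_trans nr.
by apply: ltrD; rewrite // distrC.
Qed.

Lemma measurable_open (U : set 'rV[R]_d) : open U -> measurable (U : set bR).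
Proof. by move=> oU; apply: sub_sigma_algebra. Qed.

Lemma measurable_continuous (f : 'rV[R]_d -> R) : continuous f ->
  measurable_fun [set: bR] (f : bR -> R).
Proof.
move=> cf; apply: (measurability _ (RGenOpens.measurableE R)).
move=> _ [_ [a [b ->]] <-]; rewrite setTI.
apply: measurable_open; apply: open_comp => [x _|]; [exact: cf|].
exact: interval_open.
Qed.

Lemma measurable_borel_fun (f : 'rV[R]_d -> R) :
  borel_fun f <-> measurable_fun [set: bR] (f : bR -> R).
Proof.
split=> [bf|mf U oU].
  apply: (measurability _ (RGenOpens.measurableE R)).
  by move=> _ [_ [a [b ->]] <-]; rewrite setTI; apply: bf; exact: interval_open.
have := mf measurableT U (open_measurable oU); by rewrite setTI.
Qed.

Lemma measurable_coord i : measurable_fun [set: bR] (fun x : bR => (x : 'rV[R]_d) ord0 i).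
Proof. apply: measurable_continuous; exact: coord_continuous. Qed.

(** Every open set is a countable union of boxes, and the preimage of a box is a finite intersection
    of coordinate conditions. *)
Lemma measurable_rowP dT (T : measurableType dT) (f : T -> 'rV[R]_d) :
  (forall i, measurable_fun setT (fun t => f t ord0 i)) ->
  measurable_fun setT (f : T -> bR).
Proof.
move=> mf; apply: (@measurability _ _ _ bR _ _ [set U : set 'rV[R]_d | open U]) => //.
move=> _ [U oU <-]; rewrite setTI.
rewrite (_ : f @^-1` U = \bigcup_q
    (if `[< ratbox q `<=` U >] then f @^-1` (ratbox q) else set0)).
  apply: countable_bigcupT_measurable => // q; case: ifPn => // _.
  rewrite (_ : _ @^-1` _ = \bigcap_(i in [set: 'I_d])
     (fun t => f t ord0 i) @^-1` (ball (ratr (q.1 i) : R) (q.2.+1%:R^-1))).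
    apply: fin_bigcap_measurable => // i _; rewrite -[X in measurable X]setTI.
    by apply: mf => //; apply: open_measurable; exact: ball_open.
  apply/seteqP; split => t /=.
    by move=> h i _ /=; rewrite /ball /= distrC.
  by move=> h i; have := h i I; rewrite /ball /= distrC.
apply/seteqP; split => t /=.
  move=> Ut; have [q qt qU] := ratbox_basis oU Ut.
  by exists q => //; case: asboolP.
by move=> [q _]; case: asboolP => // qU /qU.
Qed.

End BorelRow.

(** * The measure behind [iint], by induction on the dimension *)

Section IteratedIntegral.
Variable R : realType.

Definition rowcons (d : nat) (p : R * 'rV[R]_d) : 'rV[R]_(d.+1) :=
  row_mx (\row_(_ < 1) p.1) p.2.

Lemma rowcons_lshift (d : nat) (p : R * 'rV[R]_d) (j : 'I_1) :
  (rowcons p : 'rV_(1 + d)) ord0 (lshift d j) = p.1.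
Proof. by rewrite /rowcons row_mxEl mxE. Qed.

Lemma rowcons_rshift (d : nat) (p : R * 'rV[R]_d) (j : 'I_d) :
  (rowcons p : 'rV_(1 + d)) ord0 (rshift 1 j) = p.2 ord0 j.
Proof. by rewrite /rowcons row_mxEr. Qed.

Lemma measurable_rowcons (d : nat) :
  measurable_fun setT (@rowcons d : (R * borelRow R d)%type -> borelRow R d.+1).
Proof.
apply: measurable_rowP => i.
case: (@splitP 1 d i) => j ij.
  rewrite (_ : i = lshift d j); last exact: val_inj.
  rewrite (_ : (fun _ => _) = fst); first exact: measurable_fst.
  by apply/funext => p; exact: rowcons_lshift.
rewrite (_ : i = rshift 1 j); last exact: val_inj.
rewrite (_ : (fun _ => _) = (fun y : borelRow R d => (y : 'rV_d) ord0 j) \o snd).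
  by apply: measurableT_comp; [exact: measurable_coord|exact: measurable_snd].
by apply/funext => p; exact: rowcons_rshift.
Qed.

Lemma iintS (d : nat) (f : 'rV[R]_d.+1 -> \bar R) :
  iint f = (\int[@lebesgue_measure R]_t iint (fun y => f (rowcons (t, y))))%E.
Proof. by []. Qed.

(* Integrability is not assumed: for an integrable [f] the slices may still be
   non-integrable on a null set of parameters, where [iint] is a junk value. *)
Lemma measurable_iint (d : nat) : forall dT (T : measurableType dT)
    (f : T * borelRow R d -> \bar R), measurable_fun setT f ->
  measurable_fun setT (fun t => iint (fun y : 'rV[R]_d => f (t, y))).
Proof.
elim: d => [|d IH] dT T f mf.
  apply: (measurableT_comp mf (g := fun t => (t, 0 : borelRow R 0))).
  apply: measurable_fun_pair => //; exact: measurable_cst.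
(* The first coordinate joins the parameter, so the induction has to range over all parameter
   spaces. *)
pose h (p : T * R) := iint (fun y : 'rV[R]_d => f (p.1, rowcons (p.2, y))).
have mh : measurable_fun setT h.
  apply: (IH _ (T * R)%type (fun q => f (q.1.1, rowcons (q.1.2, q.2)))).
  apply: (measurableT_comp mf).
  apply: measurable_fun_pair.
    by apply: measurableT_comp; [exact: measurable_fst|exact: measurable_fst].
  apply: (measurableT_comp (@measurable_rowcons d)
     (g := fun q : (T * R) * borelRow R d => (q.1.2, q.2))).
  apply: measurable_fun_pair; last exact: measurable_snd.
  by apply: measurableT_comp; [exact: measurable_snd|exact: measurable_fst].
have -> : (fun t => iint (fun y => f (t, y))) =
    (fubini_F (@lebesgue_measure R) h^\+ \- fubini_F (@lebesgue_measure R) h^\-)%E.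
  apply/funext => t; rewrite [LHS]iintS [LHS]integralE.
  rewrite /fubini_F; congr (adde _ (oppe _)); apply: eq_integral => x _.
    by rewrite (funepos_comp h (pair t)).
  by rewrite (funeneg_comp h (pair t)).
apply: emeasurable_funB.
  by apply: measurable_fun_fubini_tonelli_F => //; exact: measurable_funepos.
by apply: measurable_fun_fubini_tonelli_F => //; exact: measurable_funeneg.
Qed.

Definition cube (d : nat) (M : R) : set 'rV[R]_d :=
  [set x | forall i, `|x ord0 i| <= M].

Lemma measurable_cube (d : nat) M : measurable (@cube d M : set (borelRow R d)).
Proof.
rewrite (_ : @cube d M = \bigcap_(i in [set: 'I_d])
   (fun x : borelRow R d => (x : 'rV_d) ord0 i) @^-1` [set r : R | `|r| <= M]).
  apply: fin_bigcap_measurable => // i _; rewrite -[X in measurable X]setTI.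
  apply: measurable_coord => //.
  rewrite (_ : [set r | _] = `[- M, M]%classic); first exact: measurable_itv.
  by apply/seteqP; split => r /=; rewrite in_itv /= ler_norml.
by apply/seteqP; split => x h i; [move=> _; exact: h|exact: h i I].
Qed.

Lemma cube_sigma_finite (d : nat) (mu : {measure set (borelRow R d) -> \bar R}) :
  (forall M, mu (@cube d M) < +oo)%E -> sigma_finite setT mu.
Proof.
move=> cfin; exists (fun n => @cube d n%:R); last first.
  by move=> n; split; [exact: measurable_cube|exact: cfin].
apply/seteqP; split => // x _.
exists (Num.trunc (\sum_i `|x ord0 i|)).+1 => //= i.
apply: (@le_trans _ _ (\sum_i `|x ord0 i|)); last exact/ltW/truncnS_gt.
by rewrite (bigD1 i) //= lerDl sumr_ge0.
Qed.

Section consMeasure.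
Variables (d : nat) (mu : {sigma_finite_measure set (borelRow R d) -> \bar R}).

Let rc : (measurableTypeR R * borelRow R d)%type -> borelRow R d.+1 :=
  @rowcons d.

Let mrc : measurable_fun setT rc.
Proof. exact: measurable_rowcons. Qed.

Definition consMeasure : set (borelRow R d.+1) -> \bar R :=
  pushforward (@lebesgue_measure R \x mu)%E rc.

HB.instance Definition _ := Measure.copy consMeasure
  (measure_function_pushforward__canonical__measure_function_Measure
    (@lebesgue_measure R \x mu)%E mrc).

Hypothesis mu_iint : forall f : borelRow R d -> \bar R,
  mu.-integrable setT f -> iint f = (\int[mu]_x f x)%E.
Hypothesis mu_iint_ge0 : forall f : borelRow R d -> \bar R,
  measurable_fun setT f -> (forall x, 0 <= f x)%E ->
  iint f = (\int[mu]_x f x)%E.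
Hypothesis mu_cube : forall M, (mu (@cube d M) < +oo)%E.

Lemma consMeasure_cube M : (consMeasure (@cube d.+1 M) < +oo)%E.
Proof.
rewrite /consMeasure /pushforward.
have sub : rc @^-1` @cube d.+1 M `<=` `[- M, M] `*` @cube d M.
  move=> p /= h; split => /=.
    by rewrite in_itv /= -ler_norml -(rowcons_lshift p ord0); exact: h.
  by move=> i; rewrite -(rowcons_rshift p i); exact: h.
apply: (@le_lt_trans _ _ ((@lebesgue_measure R \x mu)%E (`[- M, M] `*` @cube d M))).
  apply: le_measure => //; rewrite inE.
    by rewrite -[X in measurable X]setTI; apply: mrc => //; exact: measurable_cube.
  by apply: measurableX; [exact: measurable_itv|exact: measurable_cube].
rewrite product_measure1E; [|exact: measurable_itv|exact: measurable_cube].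
have itv_fin : @lebesgue_measure R `[- M, M]%classic \is a fin_num.
  by rewrite lebesgue_measure_itv /=; case: ifP.
by rewrite lte_mul_pinfty.
Qed.

HB.instance Definition _ := Measure_isSigmaFinite.Build _ _ _ consMeasure
  (cube_sigma_finite consMeasure_cube).

Definition consSigmaFiniteMeasure :
  {sigma_finite_measure set (borelRow R d.+1) -> \bar R} := consMeasure.

Lemma consMeasure_iint (f : borelRow R d.+1 -> \bar R) :
  consMeasure.-integrable setT f -> iint f = (\int[consMeasure]_x f x)%E.
Proof.
move=> fi; have mf := measurable_int _ fi.
have mfrc : measurable_fun setT (f \o rc) by exact: measurableT_comp.
have ifrc : (@lebesgue_measure R \x mu)%E.-integrable setT (f \o rc).
  apply/integrableP; split => //.
  have /integrableP[_] := fi.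
  rewrite (ge0_integral_pushforward mrc) //=.
  exact: measurableT_comp.
rewrite iintS (integral_pushforward mrc) //.
rewrite -integral12_prod_meas1 // /fubini_F.
(* By Fubini almost every slice is integrable, and only there does [mu_iint] apply. On the other
   slices the two inner values may differ, so both must be known to be measurable in [t]. *)
apply: (@ae_eq_integral _ _ _ (@lebesgue_measure R) setT
  (fun t => \int[mu]_y (f \o rc) (t, y))%E) => //.
- exact: (measurable_iint mfrc).
- exact: (measurable_fubini_F ifrc).
- have := ae_integrable1 ifrc; apply: filterS => t tint _ /=.
  exact: mu_iint.
Qed.

Lemma consMeasure_iint_ge0 (f : borelRow R d.+1 -> \bar R) :
  measurable_fun setT f -> (forall x, 0 <= f x)%E ->
  iint f = (\int[consMeasure]_x f x)%E.
Proof.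
move=> mf f0.
have mfrc : measurable_fun setT (f \o rc) by exact: measurableT_comp.
rewrite iintS (ge0_integral_pushforward mrc) //.
rewrite fubini_tonelli1 //; last by move=> x; exact: f0.
apply: (@eq_integral _ _ _ (@lebesgue_measure R)) => t _.
apply: (mu_iint_ge0 (f := fun y => f (rc (t, y)))) => //.
apply: (measurableT_comp mfrc (g := pair t)).
by apply: measurable_fun_pair => //; exact: measurable_cst.
Qed.

End consMeasure.

(** The induction starts from a Dirac mass and adds one Lebesgue factor at a time. The nonnegative
    case covers volumes of sets, possibly infinite; finiteness on cubes gives sigma-finiteness at
    the next stage and finite volume of compact regions. *)
Lemma iint_measure (d : nat) :
  exists mu : {sigma_finite_measure set (borelRow R d) -> \bar R},
  [/\ forall f : borelRow R d -> \bar R,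
        mu.-integrable setT f -> iint f = (\int[mu]_x f x)%E,
      forall f : borelRow R d -> \bar R,
        measurable_fun setT f -> (forall x, 0 <= f x)%E ->
        iint f = (\int[mu]_x f x)%E
    & forall M, (mu (@cube d M) < +oo)%E].
Proof.
elim: d => [|d [mu [mi mge mc]]].
  exists (\d_(0 : borelRow R 0)); split.
  - by move=> f /measurable_int mf; rewrite integral_dirac // diracT mul1e.
  - by move=> f mf _; rewrite integral_dirac // diracT mul1e.
  - move=> M; exact: (ltry (\1_(@cube 0 M) (0 : 'rV[R]_0))).
exists (consSigmaFiniteMeasure mc); split.
- exact: consMeasure_iint.
- exact: consMeasure_iint_ge0.
- exact: consMeasure_cube.
Qed.

End IteratedIntegral.

(** * Perturbing the minimizer *)

(** A supremum of continuous affine functions is lower semicontinuous: its strict superlevel sets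
    are open. *)
Lemma measurable_sigma (R : realType) (d D : nat) (e : 'I_D -> 'rV[R]_d) :
  measurable_fun setT (sigma e : borelRow R d -> \bar R).
Proof.
apply: (measurability _ (ErealGenOInfty.measurableE R)).
move=> _ [_ [r ->] <-]; rewrite setTI; apply: measurable_open.
rewrite (_ : _ @^-1` _ = \bigcup_a
    [set s | r + ln (\sum_j expR (dotv (e j) a)) < dotv a s]).
  apply: bigcup_open => a _.
  apply: (@open_comp _ _ (dotv a) [set y | _ < y]); last exact: open_gt.
  by move=> s _; exact: dotv_continuous.
apply/seteqP; split => s /=; rewrite in_itv /= andbT.
  move=> rs; apply: contrapT => h.
  have /sigma_le : forall a, dotv s a - ln (\sum_j expR (dotv (e j) a)) <= r.
    move=> a; rewrite lerBlDr leNgt; apply/negP => ra; apply: h.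
    by exists a => //=; rewrite dotvC.
  by rewrite leNgt rs.
move=> [a _ /= ra]; rewrite ltNge; apply/negP => /sigma_le /(_ a).
by rewrite lerBlDr leNgt dotvC ra.
Qed.

Section AEIntegral.
Local Open Scope ereal_scope.
Context dT (T : measurableType dT) (R : realType).
Variable mu : {measure set T -> \bar R}.

Lemma integrable_indicZ (A : set T) (C : R) : measurable A -> mu A < +oo ->
  mu.-integrable setT (fun x => (C * \1_A x)%:E).
Proof.
move=> mA Afin; under eq_fun do rewrite EFinM.
apply: integrableZl => //; apply/integrableP; split.
  by apply/measurable_EFinP; exact: measurable_indic.
under eq_integral => x _ do rewrite gee0_abs ?lee_fin //.
by rewrite integral_indic // setIT.
Qed.

Lemma integral_indicZ (A : set T) (C : R) : measurable A -> mu A < +oo ->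
  \int[mu]_x (C * \1_A x)%:E = C%:E * mu A.
Proof.
move=> mA Afin; under eq_integral do rewrite EFinM.
have /integrableZl := integrable_indicZ 1 mA Afin.
rewrite integralZl //; first by rewrite integral_indic // setIT.
by have := integrable_indicZ 1 mA Afin; under eq_fun do rewrite mul1r.
Qed.

Lemma ae_bounded_integrable (f : T -> \bar R) (A N : set T) (C : R) :
  measurable_fun setT f -> measurable A -> mu A < +oo ->
  measurable N -> mu N = 0 ->
  (forall x, ~ N x -> `|f x| <= (C * \1_A x)%:E) ->
  mu.-integrable setT f.
Proof.
move=> mf mA Afin mN N0 fC; apply/(negligible_integrable mN) => //.
have mD : measurable (setT `\` N) by exact: measurableD.
apply: (le_integrable mD (g := fun x => (C * \1_A x)%:E)).
- exact: measurable_funTS.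
- move=> x [_ Nx]; apply: le_trans (fC x Nx) _.
  by rewrite lee_fin ler_norm.
- by apply: integrableS (integrable_indicZ C mA Afin).
Qed.

Lemma ae_le_integral (f g : T -> \bar R) (N : set T) :
  mu.-integrable setT f -> mu.-integrable setT g ->
  measurable N -> mu N = 0 -> (forall x, ~ N x -> f x <= g x) ->
  \int[mu]_x f x <= \int[mu]_x g x.
Proof.
move=> fi gi mN N0 fg.
have mD : measurable (setT `\` N) by exact: measurableD.
rewrite (negligible_integral mN _ fi) // (negligible_integral mN _ gi) //.
apply: le_integral => //; [exact: integrableS fi|exact: integrableS gi|].
by move=> x; rewrite inE => -[_ Nx]; exact: fg.
Qed.

End AEIntegral.

(** * Asymptotic flows, their mixtures and the entropy comparison *)

Section Flow.
Variables (R : realType) (d D : nat) (e : 'I_D -> 'rV[R]_d).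
Variables (Rg : set 'rV[R]_d) (w0 : 'rV[R]_d -> 'rV[R]_d).
Local Notation bR := (borelRow R d).
Variable mu : {sigma_finite_measure set bR -> \bar R}.
Hypothesis mu_iint : forall f : bR -> \bar R,
  mu.-integrable setT f -> iint f = (\int[mu]_x f x)%E.
Hypothesis mu_iint_ge0 : forall f : bR -> \bar R,
  measurable_fun setT f -> (forall x, 0 <= f x)%E ->
  iint f = (\int[mu]_x f x)%E.
Hypothesis mu_cube : forall M, (mu (@cube R d M) < +oo)%E.
Hypothesis cRg : compact Rg.

Lemma leb_measure (A : set bR) : measurable A -> leb A = mu A.
Proof.
move=> mA; rewrite /leb mu_iint_ge0.
- by rewrite integral_indic // setIT.
- by apply/measurable_EFinP; exact: measurable_indic.
- by move=> x; rewrite lee_fin.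
Qed.

Lemma measurable_region : measurable (Rg : set bR).
Proof.
rewrite -(setCK Rg); apply: measurableC; apply: measurable_open.
by apply: closed_openC; apply: compact_closed => //; exact: norm_hausdorff.
Qed.

Lemma region_finite : (mu Rg < +oo)%E.
Proof.
have [M [_ RM]] := compact_bounded cRg.
have : Rg `<=` @cube R d (M + 1).
  move=> x /(RM (M + 1)); rewrite ltrDl ltr01 => /(_ isT) xM i.
  apply: le_trans xM; rewrite [leRHS]/Num.norm /= mx_normrE.
  by apply/bigmax_geP; right; exists (ord0, i).
move=> sub; apply: le_lt_trans (mu_cube (M + 1)).
apply: le_measure => //; rewrite inE; [exact: measurable_region|].
exact: measurable_cube.
Qed.

Lemma flow_measurable w : asymptotic_flow e Rg w ->
  measurable_fun setT (w : bR -> bR).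
Proof.
by move=> [bw _]; apply: measurable_rowP => i; apply/measurable_borel_fun.
Qed.

Lemma flow_ae_Newton w : asymptotic_flow e Rg w ->
  exists N : set bR, [/\ measurable N, mu N = 0 & forall x, ~ N x -> Newton e (w x)].
Proof.
move=> [_ [_ [_ [N [bN [N0 NP]]]]]]; exists N; split => //.
  by rewrite -leb_measure.
by move=> x; exact: NP.
Qed.

(** [phi] may have unbounded support, but [w] vanishes off the compact [Rg], where the partial
    derivatives are bounded. *)
Lemma flux_integrable w phi : asymptotic_flow e Rg w -> smooth phi ->
  mu.-integrable setT (fun x : bR => (dotv (w x) (grad phi x))%:E).
Proof.
move=> fw /(_ 1) [_ sphi].
have cphi i : continuous (partial i phi) by have [_] := sphi i.
have /choice[C CP] i : exists C : R, forall x, Rg x -> `|partial i phi x| <= C.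
  have /compact_bounded[M [_ MP]] : compact (partial i phi @` Rg).
    by apply: continuous_compact => //; exact: continuous_subspaceT.
  exists (M + 1) => x Rx; apply: (MP (M + 1)); first by rewrite ltrDl.
  by exists x.
have [M M0 NM] := Newton_coord_bound e.
have [N [mN N0 NP]] := flow_ae_Newton fw.
apply: (@ae_bounded_integrable _ _ _ mu _ Rg N (\sum_i M * C i)) => //.
- apply/measurable_EFinP; rewrite /dotv; apply: measurable_sum => i.
  apply: measurable_funM.
    by have [bw _] := fw; apply/measurable_borel_fun.
  rewrite (_ : (fun _ => _) = partial i phi).
    exact: measurable_continuous.
  by apply/funext => x; rewrite mxE.
- exact: measurable_region.
- exact: region_finite.
- move=> x Nx; rewrite abse_EFin lee_fin.
  have [Rx|Rx] := pselect (Rg x); last first.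
    have [_ [w0' _]] := fw; rewrite (w0' _ Rx) dotv0l normr0.
    by rewrite indicE memNset // mulr0.
  rewrite indicE mem_set // mulr1 /dotv.
  apply: le_trans (ler_norm_sum _ _ _) _; apply: ler_sum => i _.
  rewrite normrM; apply: ler_pM => //; first exact: NM (NP x Nx) i.
  by rewrite mxE; exact: CP.
Qed.

Definition mixv (k : R) (w w' : 'rV[R]_d -> 'rV[R]_d) x :=
  (1 - k) *: w x + k *: w' x.

Lemma AF_convex w w' k : AF e Rg w0 w -> AF e Rg w0 w' -> 0 <= k <= 1 ->
  AF e Rg w0 (mixv k w w').
Proof.
move=> [fw sw] [fw' sw'] k01.
have sm : same_flux (mixv k w w') w0.
  move=> phi sphi.
  have iw := flux_integrable fw sphi; have iw' := flux_integrable fw' sphi.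
  have E : (\int[mu]_x (dotv (w x) (grad phi x))%:E)%E = flux w0 phi.
    by rewrite -mu_iint //; exact: sw.
  have E' : (\int[mu]_x (dotv (w' x) (grad phi x))%:E)%E = flux w0 phi.
    by rewrite -mu_iint //; exact: sw'.
  have Ffin : flux w0 phi \is a fin_num by rewrite -E integrable_fin_num.
  have im1 := integrableZl measurableT (1 - k) iw.
  have im2 := integrableZl measurableT k iw'.
  have mixE : (fun x : bR => (dotv (mixv k w w' x) (grad phi x))%:E) =
      (fun x : bR => ((1 - k)%:E * (dotv (w x) (grad phi x))%:E +
                 k%:E * (dotv (w' x) (grad phi x))%:E)%E).
    by apply/funext => x; rewrite dotvDl !dotvZl EFinD !EFinM.
  rewrite /flux mixE mu_iint; last exact: integrableD.
  rewrite integralD // !integralZl // E E' -ge0_muleDl.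
  - by rewrite -EFinD subrK mul1e.
  - by rewrite lee_fin subr_ge0; case/andP: k01.
  - by rewrite lee_fin; case/andP: k01.
split => //; split; [|split; [|split]].
- move=> i; apply/measurable_borel_fun.
  have [bw _] := fw; have [bw' _] := fw'.
  rewrite (_ : (fun _ => _) = (fun x : bR =>
      (1 - k) * w x ord0 i + k * w' x ord0 i)).
    2: by apply/funext => x; rewrite !mxE.
  by apply: measurable_funD; apply: measurable_funM => //;
    apply/measurable_borel_fun.
- move=> x Rx; have [_ [off _]] := fw; have [_ [off' _]] := fw'.
  by rewrite /mixv off // off' // !scaler0 addr0.
(* The test functions for the divergence are among those for the flux, so the mixture inherits the
   vanishing from [w]. *)
- move=> phi sphi cphi Uphi; have [_ [_ [dw _]]] := fw.
  have := sm _ sphi; rewrite -(sw _ sphi) /flux => ->.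
  exact: dw.
- have [N [mN N0 NP]] := flow_ae_Newton fw.
  have [N' [mN' N0' NP']] := flow_ae_Newton fw'.
  have mNN : measurable (N `|` N' : set bR) by exact: measurableU.
  exists (N `|` N'); split; first exact: mNN.
  split.
    rewrite leb_measure //; apply: measure_negligible => //.
    by apply: negligibleU; apply/negligibleP.
  move=> x _ Nx; apply: Newton_convex => //.
    by apply: NP => ?; apply: Nx; left.
  by apply: NP' => ?; apply: Nx; right.
Qed.

Definition entropy_density (w : bR -> bR) (x : bR) : \bar R :=
  if x \in Rg then sigma e (w x) else 0%E.

Lemma entropy_density_integrable w : asymptotic_flow e Rg w ->
  mu.-integrable setT (entropy_density w).
Proof.
move=> fw; have [N [mN N0 NP]] := flow_ae_Newton fw.
apply: (@ae_bounded_integrable _ _ _ mu _ Rg N `|ln D%:R|) => //.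
- apply: measurable_fun_ifT => //.
    apply: (measurable_fun_bool true) => //=.
    rewrite setTI (_ : _ @^-1` _ = Rg); first exact: measurable_region.
    by apply/seteqP; split => x; [exact: set_mem|exact: mem_set].
  exact: measurableT_comp (measurable_sigma e) (flow_measurable fw).
- exact: measurable_region.
- exact: region_finite.
- move=> x Nx; rewrite /entropy_density indicE; case: ifPn => xR.
    rewrite mulr1 lee0_abs ?sigma_le0 //; last exact: NP.
    rewrite leeNl; apply: le_trans (sigma_ge e (w x)).
    by rewrite -EFinN lee_fin lerN2 ler_norm.
  by rewrite abse0 mulr0.
Qed.

Lemma entropyE w : asymptotic_flow e Rg w ->
  entropy e Rg w = (\int[mu]_x entropy_density w x)%E.
Proof. by move=> fw; apply: mu_iint; exact: entropy_density_integrable. Qed.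

Hypothesis spe : spans e.
Hypothesis e0 : \sum_j e j = 0.

(** If a grade [A n] of the bad set had measure [a > 0], mixing would cost at most [eps * L * rho]
    over the region of volume [rho] and gain at least [eps * m * K * a] on [A n]. A large [K]
    contradicts minimality. *)
Lemma minimizer_interior_local (B : set bR) w w' :
  measurable B -> AF e Rg w0 w -> AF e Rg w0 w' ->
  (forall w'', AF e Rg w0 w'' -> (entropy e Rg w <= entropy e Rg w'')%E) ->
  ae_in B (fun x => interior (Newton e) (w' x)) ->
  mu.-negligible [set x | [/\ interior Rg x, B x & ~ interior (Newton e) (w x)]].
Proof.
move=> mB Aw Aw' wmin [N2 [mN2 [N20 N2P]]].
have [fw _] := Aw; have [fw' _] := Aw'.
have [N [mN N0 NP]] := flow_ae_Newton fw.
have [N' [mN' N0' NP']] := flow_ae_Newton fw'.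
pose N1 : set bR := N `|` N'.
have mN1 : measurable N1 by exact: measurableU.
have N10 : mu N1 = 0.
  by apply: measure_negligible => //; apply: negligibleU; apply/negligibleP.
pose bad : set bR :=
  [set x | [/\ interior Rg x, B x & ~ interior (Newton e) (w x)]].
have mbad : measurable bad.
  rewrite (_ : bad = ((interior Rg : set bR) `&` B) `&`
      ~` ((w : bR -> bR) @^-1` (interior (Newton e)))).
    apply: measurableI.
      by apply: measurableI => //; apply: measurable_open; exact: open_interior.
    apply: measurableC; rewrite -[X in measurable X]setTI.
    by apply: (flow_measurable fw) => //; apply: measurable_open; exact: open_interior.
  by apply/seteqP; split => x; [move=> [? ? ?]|move=> [[? ?] ?]].
pose A n : set bR := bad `&`
  [set x | interior (Newton e) ((1 + n.+1%:R^-1) *: w' x)].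
have mA n : measurable (A n).
  apply: measurableI => //; rewrite -[X in measurable X]setTI.
  pose V := [set y : 'rV[R]_d | interior (Newton e) ((1 + n.+1%:R^-1) *: y)].
  apply: (flow_measurable fw' measurableT (Y := V : set bR)).
  apply: measurable_open.
  apply: (@open_comp _ _ (fun y : 'rV[R]_d => (1 + n.+1%:R^-1) *: y)
      (interior (Newton e))).
    by move=> y _; exact: scaler_continuous.
  exact: open_interior.
suff A0 n : mu (A n) = 0.
  have : mu.-negligible (N2 `|` \bigcup_n A n).
    have muN2 : mu N2 = 0 by rewrite -leb_measure.
    apply: negligibleU; first exact/negligibleP.
    by apply: negligible_bigcup => n; apply/negligibleP; [exact: mA|exact: A0].
  apply: negligibleS => x badx; have [Rx Bx wx] := badx.
  have [N2x|N2x] := pselect (N2 x); [by left|right].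
  have [n wn] := interior_Newton_dilate (N2P x Bx N2x).
  by exists n.
have AR : A n `<=` Rg by move=> x [[Rx _ _] _]; exact: interior_subset.
have mR := measurable_region; have Rfin := region_finite.
have Afin : (mu (A n) < +oo)%E.
  by apply: le_lt_trans Rfin; apply: le_measure => //; rewrite inE.
apply/eqP; rewrite eq_le measure_ge0 andbT leNgt; apply/negP => Apos.
have aE : (fine (mu (A n)))%:E = mu (A n) by rewrite fineK // ge0_fin_numE.
have rE : (fine (mu Rg))%:E = mu Rg by rewrite fineK // ge0_fin_numE.
set a := fine (mu (A n)) in aE; set rho := fine (mu Rg) in rE.
have a0 : 0 < a by rewrite -lte_fin aE.
have rho0 : 0 <= rho by rewrite -lee_fin rE.
have A1 : A n !=set0.
  apply: contrapT => /set0P/negP/negPn/eqP A0; by rewrite A0 measure0 ltxx in Apos.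
have D0 : (0 < D)%N.
  have [x [_ /interior_subset]] := A1; exact: Newton_card.
pose k : R := n.+1%:R^-1.
have k0 : 0 < k by rewrite invr_gt0.
pose m := k / (1 + k) / D%:R.
have m0 : 0 < m by rewrite !divr_gt0 ?ltr0n // ltr_pwDl // ltW.
pose L := `|ln (D%:R : R)|.
(* The first entry makes the gain exceed the cost by at least [eps]; the second ensures
   [eps <= 1 / 2]. *)
pose K := Num.max ((L * rho + 1) / (m * a)) (- ln m).
have K1 : (L * rho + 1) / (m * a) <= K by rewrite /K le_max lexx.
(* Chosen so that [2 * c = expR (- K)] for [c = eps * m], that is [ln (2 * c) = - K]. *)
pose eps := expR (- K) / (2 * m).
have eps0 : 0 < eps by rewrite divr_gt0 ?expR_gt0 // mulr_gt0.
have eps2 : eps <= 2^-1.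
  have m20 : 0 < 2 * m by rewrite mulr_gt0.
  rewrite /eps ler_pdivrMr // (_ : 2^-1 * (2 * m) = m); last by field.
  by rewrite -[leRHS]lnK ?posrE // ler_expR lerNl le_max lexx orbT.
pose c := eps * m.
have lnc : ln (2 * c) = - K.
  rewrite (_ : 2 * c = expR (- K)) ?expRK // /c /eps; field.
  by rewrite gt_eqF.
have eps01 : 0 <= eps <= 1.
  rewrite ltW //=; apply: le_trans eps2 _; rewrite invf_le1 //; lra.
have Aeps := AF_convex Aw Aw' eps01.
have [feps _] := Aeps.
have := wmin _ Aeps; rewrite !entropyE //.
pose f := entropy_density w; pose g := entropy_density (mixv eps w w').
have fi : mu.-integrable setT f by exact: entropy_density_integrable.
have gi : mu.-integrable setT g by exact: entropy_density_integrable.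
(* As [r >= - L], the value [(1 - eps) * r] exceeds [r] by at most [eps * L]; [bA] records the gain
   on [A n]. *)
pose bR1 := fun x : bR => ((eps * L) * \1_Rg x)%:E.
pose bA := fun x : bR => ((c * - K) * \1_(A n) x)%:E.
have bR1i : mu.-integrable setT bR1 by exact: integrable_indicZ.
have bAi : mu.-integrable setT bA by exact: integrable_indicZ.
have gle : (\int[mu]_x g x <= \int[mu]_x (f x + (bR1 x + bA x)))%E.
  apply: (ae_le_integral gi _ mN1 N10).
    by apply: integrableD => //; exact: integrableD.
  move=> x Nx.
  have wN : Newton e (w x) by apply: NP => ?; apply: Nx; left.
  have wN' : Newton e (w' x) by apply: NP' => ?; apply: Nx; right.
  rewrite /f /g /entropy_density /bR1 /bA !indicE.
  case: ifPn => [/set_mem xR|/negP xR]; last first.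
    rewrite memNset ?mulr0; last by move=> /AR /mem_set.
    by rewrite !add0e.
  rewrite mulr1.
  have sfin : sigma e (w x) \is a fin_num.
    rewrite fin_numE; apply/andP; split.
      by rewrite gt_eqF // (lt_le_trans _ (sigma_ge e (w x))) // ltNyr.
    by rewrite lt_eqF // (le_lt_trans (sigma_le0 wN)) // ltry.
  have sE := fineK sfin; set r := fine _ in sE.
  have rL : - L <= r.
    rewrite -lee_fin sE; apply: le_trans (sigma_ge e (w x)).
    by rewrite lee_fin lerN2 ler_norm.
  have r0 : (sigma e (w x) <= r%:E)%E by rewrite sE.
  rewrite -sE -!EFinD.
  have [/set_mem xA|xA] := boolP (x \in A n).
    have [[Rx Bx nint] w'n] := xA.
    have [v v0 sv] := exists_supporting spe e0 wN nint.
    have := sigma_steep wN e0 sv (supporting_strict spe e0 v0 sv D0) k0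
      (interior_subset w'n) _ r0 (eps := eps).
    rewrite eps0 eps2 => /(_ isT) /= h; apply: le_trans h _.
    rewrite -/k -/m -/c lnc lee_fin mulr1.
    have : 0 <= eps * (L + r) by apply: mulr_ge0; [exact: ltW|lra].
    lra.
  have := sigma_convex_le wN' eps01 r0 => h; apply: le_trans h _.
  rewrite lee_fin mulr0 addr0.
  have : 0 <= eps * (L + r) by apply: mulr_ge0; [exact: ltW|lra].
  lra.
move=> fg; have := le_trans fg gle.
rewrite !integralD //; last exact: integrableD.
have If := integrable_fin_num measurableT fi.
have IR : (\int[mu]_x bR1 x = (eps * L)%:E * rho%:E)%E.
  by rewrite rE; exact: integral_indicZ.
have IA : (\int[mu]_x bA x = (c * - K)%:E * a%:E)%E.
  by rewrite aE; exact: integral_indicZ.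
rewrite IR IA -(fineK If) -!EFinM -!EFinD lee_fin lerDl.
have h1 : L * rho + 1 <= K * (m * a).
  have ma0 : 0 < m * a by rewrite mulr_gt0.
  by rewrite -ler_pdivrMr.
have : eps * (L * rho + 1) <= eps * (K * (m * a)) by rewrite ler_pM2l.
rewrite /c => h2 h3.
suff : eps <= 0 by rewrite leNgt eps0.
lra.
Qed.

End Flow.

Theorem mainTheorem14 (R : realType) (d D : nat) (e : 'I_D -> 'rV[R]_d)
    (Rg : set 'rV[R]_d) (w0 w : 'rV[R]_d -> 'rV[R]_d) :
  spans e ->
  \sum_(j < D) e j = 0 ->
  compact Rg -> connected Rg -> is_domain Rg ->
  piecewise_smooth_boundary Rg ->
  asymptotic_flow e Rg w0 ->
  flexible e Rg w0 ->
  AF e Rg w0 w ->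
  (forall w', AF e Rg w0 w' -> (entropy e Rg w <= entropy e Rg w')%E) ->
  ae_in (interior Rg) (fun x => interior (Newton e) (w x)).
Proof.
move=> spe e0 cR _ _ _ _ flex Aw wmin.
have [mu [mi mge mc]] := iint_measure R d.
have [fw _] := Aw.
pose N : set (borelRow R d) :=
  [set x | interior Rg x /\ ~ interior (Newton e) (w x)].
have mN : measurable N.
  apply: measurableI; first by apply: measurable_open; exact: open_interior.
  apply: measurableC; rewrite -[X in measurable X]setTI.
  by apply: (flow_measurable fw) => //; apply: measurable_open; exact: open_interior.
exists N; split; [exact: mN|split]; last first.
  by move=> x Rx Nx; apply: contrapT => wx; apply: Nx.
rewrite (leb_measure mge) //; apply: measure_negligible => //.
(* One competitor has to serve a whole box. Flexibility places every bad point in such a box, so the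
   neighbourhoods it provides are replaced by countably many. *)
pose good q := exists2 w', AF e Rg w0 w' &
  ae_in (@ratbox R d q) (fun y => interior (Newton e) (w' y)).
pose F k : set (borelRow R d) :=
  if unpickle k is Some q then [set x | good q /\ N x /\ @ratbox R d q x] else set0.
apply: (@negligibleS _ _ _ _ (\bigcup_k F k)).
  move=> x Nx; have [Rx _] := Nx.
  have [U [oU [Ux [w' [Aw' [N' [bN' [N'0 N'P]]]]]]]] := flex x Rx.
  have [q qx qU] := ratbox_basis oU Ux.
  exists (pickle q) => //; rewrite /F pickleK; split => //.
  exists w' => //; exists N'; split => //; split => // y /qU; exact: N'P.
apply: negligible_bigcup => k; rewrite /F.
case: (unpickle k) => [q|]; last exact: negligible_set0.
have [[w' Aw' aew']|ngood] := pselect (good q); last first.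
  by apply: negligibleS (@negligible_set0 _ _ _ mu) => x [].
have mB : measurable (@ratbox R d q : set (borelRow R d)).
  by apply: measurable_open; exact: open_ratbox.
apply: (negligibleS _ (minimizer_interior_local mi mge mc cR spe e0 mB Aw Aw' wmin aew')).
by move=> x [_ [[Rx wx] qx]].
Qed.
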